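(* Let $\mathfrak g$ be a Lie algebra over $\mathbb K$, with $\mathcal G$ the space of inner $3$-gradings and $\mathcal F$ the space of inner $3$-filtrations of $\mathfrak g$. (1) The map $D\mapsto(\mathfrak f^+(D),\mathfrak f^-(D))$ identifies $\mathcal G$ with the set $(\mathcal F\times\mathcal F)^\top=\{(\mathfrak e,\mathfrak f)\in\mathcal F\times\mathcal F:\mathfrak e\top\mathfrak f\}$ of transversal pairs of inner $3$-filtrations. In other words, two inner $3$-filtrations $\mathfrak e$ and $\mathfrak f$ are transversal if and only if there exists an Euler operator $E\in\mathfrak g$ such that $\mathfrak f=\mathfrak f^+(\mathrm{ad}(E))$ and $\mathfrak e=\mathfrak f^-(\mathrm{ad}(E))$. (2) For every inner $3$-filtration $\mathfrak f=(\mathfrak f_1,\mathfrak f_0)$, the set $\mathfrak f^\top=\{\mathfrak e\in\mathcal F:\mathfrak e\top\mathfrak f\}$ carries a natural structure of an affine space over $\mathbb K$ with translation group $(\mathfrak f_1,+)$: the group $(\mathfrak f_1,+)$ acts simply transitively on $\mathfrak f^\top$ by $x.\mathfrak e:=e^{\mathrm{ad}\,x}.\mathfrak e$.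
   Context: $\mathbb K$ is a commutative ring with unit in which $2$ and $3$ are invertible; $\mathfrak g$ is a Lie algebra over $\mathbb K$. An Euler operator is an element $E\in\mathfrak g$ with $\mathrm{ad}(E)^3=\mathrm{ad}(E)$. The space of inner $3$-gradings is $\mathcal G=\{\mathrm{ad}(E):E\in\mathfrak g,\ \mathrm{ad}(E)^3=\mathrm{ad}(E)\}$. Each $D\in\mathcal G$ is diagonalizable with eigenspaces $\mathfrak g_i=\{X: DX=iX\}$, $i=1,0,-1$, and $\mathfrak g=\mathfrak g_1\oplus\mathfrak g_0\oplus\mathfrak g_{-1}$ is a $3$-grading, i.e. $[\mathfrak g_k,\mathfrak g_l]\subset\mathfrak g_{k+l}$ (with $\mathfrak g_j=0$ for $|j|>1$). A $3$-filtration of $\mathfrak g$ is a flag of $\mathbb K$-submodules $0=\mathfrak f_2\subset\mathfrak f_1\subset\mathfrak f_0\subset\mathfrak f_{-1}=\mathfrak g$, abbreviated $\mathfrak f=(\mathfrak f_1,\mathfrak f_0)$, with $[\mathfrak f_k,\mathfrak f_l]\subset\mathfrak f_{k+l}$. For $D\in\mathcal G$ put $\mathfrak f^+(D)=(\mathfrak g_1,\mathfrak g_0\oplus\mathfrak g_1)$ and $\mathfrak f^-(D)=(\mathfrak g_{-1},\mathfrak g_0\oplus\mathfrak g_{-1})$. The space of inner $3$-filtrations is $\mathcal F=\{\mathfrak f^+(D):D\in\mathcal G\}$ (which also equals $\{\mathfrak f^-(D):D\in\mathcal G\}$). Two flags $\mathfrak e=(\mathfrak e_1,\mathfrak e_0)$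 and $\mathfrak f=(\mathfrak f_1,\mathfrak f_0)$ are transversal, written $\mathfrak e\top\mathfrak f$, if $\mathfrak g=\mathfrak e_1\oplus\mathfrak f_0=\mathfrak f_1\oplus\mathfrak e_0$. For $x\in\mathfrak f_1$ the operator $\mathrm{ad}\,x$ is $3$-step nilpotent and $e^{\mathrm{ad}\,x}=1+\mathrm{ad}\,x+\frac12(\mathrm{ad}\,x)^2$ is an automorphism of $\mathfrak g$; automorphisms act on flags by $g.(\mathfrak e_1,\mathfrak e_0)=(g\mathfrak e_1,g\mathfrak e_0)$. *)

(* Defs.v *)
From HB Require Import structures.
From mathcomp Require Import all_boot all_algebra.
From mathcomp Require Import boolp classical_sets functions.

Set Implicit Arguments.
Unset Strict Implicit.
Unset Printing Implicit Defensive.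

Import GRing.Theory.

Local Open Scope classical_set_scope.
Local Open Scope ring_scope.

HB.mixin Record Lmodule_isLieAlgebra (K : comUnitRingType) g
    of GRing.Lmodule K g := {
  lie : g -> g -> g ;
  lie_linear_l : forall (a : K) x y z,
    lie (a *: x + y) z = a *: lie x z + lie y z ;
  lie_linear_r : forall (a : K) x y z,
    lie x (a *: y + z) = a *: lie x y + lie x z ;
  lie_alternating : forall x, lie x x = 0 ;
  lie_jacobi : forall x y z,
    lie x (lie y z) + lie y (lie z x) + lie z (lie x y) = 0
}.

#[short(type="lieAlgType")]
HB.structure Definition LieAlgebra (K : comUnitRingType) :=
  { g of Lmodule_isLieAlgebra K g & GRing.Lmodule K g }.

Section Submodules.
Context {K : comUnitRingType} {V : lmodType K}.

Definition is_submodule (A : set V) : Prop :=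
  [/\ A 0, forall x y, A x -> A y -> A (x + y)
    & forall (a : K) x, A x -> A (a *: x)].

Definition set_add (A B : set V) : set V := [set a + b | a in A & b in B].

(* [V] is the internal direct sum of [A] and [B], meant for submodules. *)
Definition is_direct_sum (A B : set V) : Prop :=
  set_add A B = setT /\ A `&` B = [set 0].

End Submodules.

(* [X] is a (nonempty) affine space over [K] whose translation group is the
   additive group of the submodule [M] of [V], acting through [act].  The
   values of [act] outside [M] and [X] are irrelevant. *)
Record is_affine_space {K : comUnitRingType} {V : lmodType K} {T : Type}
    (M : set V) (X : set T) (act : V -> T -> T) : Prop := {
  affine_submodule : is_submodule M ;
  affine_nonempty : X !=set0 ;
  affine_closed : forall x p, M x -> X p -> X (act x p) ;
  affine_act0 : forall p, X p -> act 0 p = p ;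
  affine_actD : forall x y p, M x -> M y -> X p ->
    act (x + y) p = act x (act y p) ;
  affine_simply_transitive : forall p q, X p -> X q ->
    exists! x, M x /\ act x p = q
}.

Section InnerGradings.
Context {K : comUnitRingType} {g : lieAlgType K}.

Definition ad (x : g) : g -> g := lie x.

Definition is_euler (E : g) : Prop := ad E \o ad E \o ad E = ad E.

Definition inner_3gradings : set (g -> g) := [set ad E | E in is_euler].

Definition eigen_submodule (D : g -> g) (i : K) : set g :=
  [set x | D x = i *: x].

(* The flag [0 = f_2 <= f_1 <= f_0 <= f_(-1) = g] is the pair [(f_1, f_0)]. *)
Definition flag : Type := (set g * set g)%type.

Definition fplus (D : g -> g) : flag :=
  (eigen_submodule D 1,
   set_add (eigen_submodule D 0) (eigen_submodule D 1)).

Definition fminus (D : g -> g) : flag :=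
  (eigen_submodule D (-1),
   set_add (eigen_submodule D 0) (eigen_submodule D (-1))).

Definition inner_3filtrations : set flag := fplus @` inner_3gradings.

Definition transversal_flags (e f : flag) : Prop :=
  is_direct_sum e.1 f.2 /\ is_direct_sum f.1 e.2.

Definition transversal_pairs : set (flag * flag) :=
  [set ef | [/\ inner_3filtrations ef.1, inner_3filtrations ef.2
              & transversal_flags ef.1 ef.2]].

Definition transversal_to (f : flag) : set flag :=
  [set e | inner_3filtrations e /\ transversal_flags e f].

(* The exponential of [ad x] when [ad x] is 3-step nilpotent. *)
Definition exp_ad (x : g) : g -> g :=
  fun y => y + ad x y + 2%:R^-1 *: ad x (ad x y).

Definition flag_image (h : g -> g) (e : flag) : flag := (h @` e.1, h @` e.2).

End InnerGradings.

Arguments flag {K} g.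
Arguments inner_3gradings {K} g.
Arguments inner_3filtrations {K} g.
Arguments transversal_pairs {K} g.

(* Main.v *)
From HB Require Import structures.
Require Import Defs.
From mathcomp Require Import all_boot all_algebra.
From mathcomp Require Import boolp classical_sets functions.

Set Implicit Arguments.
Unset Strict Implicit.
Unset Printing Implicit Defensive.

Import GRing.Theory.

(** An Euler operator [E] splits [g] into the eigenspaces of [ad E] for the
    weights 1, 0 and -1 (this uses 1/2), and since [ad E] is a derivation these
    form a grading: brackets add weights, and an element of weight 2 is killed
    because [ad E ^ 3 = ad E] forces [6 x = 0].  So [fplus (ad E)] is a
    3-filtration ([fplus_3filtration]), transversal to [fminus (ad E)], and the
    two flags together recover all eigenspaces, hence [ad E]
    ([fplus_fminus_inj]).

    The heart of the matter is the converse ([euler_of_transversal]).  Let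
    [f = fplus (ad E)] and let [e] be any 3-filtration transversal to [f].
    Then [g] is the direct sum of [f.1], the intersection of [f.2] and [e.2],
    and [e.1].  The element [E] lies in [f.2], which is [f.1] plus that
    intersection; write [E = a + h] accordingly.  On the graded pieces of [f],
    [ad h] acts like [ad E], because [ad a] raises the filtration [f]; on the
    other hand [ad h] preserves [e].  Both facts together force [ad h] to act as
    1, 0 and -1 on the three summands.  Hence [h = E - a] is an Euler operator
    with [fplus (ad h) = f] and [fminus (ad h) = e].

    For the affine structure, let [x] have weight 1 for [E].  Then [exp_ad x]
    maps [E] to [E - x] and conjugates [ad E] into [ad (E - x)]
    ([exp_ad_intertwine]), so it fixes [fplus (ad E)] and moves
    [fminus (ad E)] to [fminus (ad (E - x))].  Thus the action on the flags
    transversal to [f] is the translation [E |-> E - x] on the Euler operators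
    inducing [f].  Transitivity is [euler_of_transversal] again, as it reaches
    every transversal flag by such a translation, and freeness is the
    injectivity of [D |-> (fplus D, fminus D)]: if [ad (E - x) = ad (E - y)],
    evaluation at [E] gives [x = y]. *)

Local Open Scope classical_set_scope.
Local Open Scope ring_scope.

(** * Brackets as linear maps *)

Section LieBrackets.
Context {K : comUnitRingType} {g : lieAlgType K}.
Implicit Types x y z : g.

Fact ad_is_linear x : linear (ad x).
Proof. by move=> a y z; exact: lie_linear_r. Qed.

HB.instance Definition _ x :=
  GRing.isLinear.Build K g g *:%R (ad x) (ad_is_linear x).

Lemma adDl x y z : ad (x + y) z = ad x z + ad y z.
Proof. by rewrite /ad -[x]scale1r lie_linear_l !scale1r. Qed.

Lemma ad0l z : ad 0 z = 0.
Proof. by apply: (addrI (ad 0 z)); rewrite -adDl !addr0. Qed.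

Lemma adNl x z : ad (- x) z = - ad x z.
Proof. by apply: (addrI (ad x z)); rewrite -adDl !subrr ad0l. Qed.

Lemma adBl x y z : ad (x - y) z = ad x z - ad y z.
Proof. by rewrite adDl adNl. Qed.

Lemma adxx x : ad x x = 0.
Proof. exact: lie_alternating. Qed.

Lemma adC x y : ad x y = - ad y x.
Proof.
have := adxx (x + y); rewrite adDl !linearD /= !adxx addr0 add0r.
by move/eqP; rewrite addr_eq0 => /eqP.
Qed.

Lemma ad_leibniz x y z : ad x (ad y z) = ad (ad x y) z + ad y (ad x z).
Proof.
have := lie_jacobi x y z; rewrite -!/(ad _ _) (adC z (ad x y)) (adC z x).
rewrite linearN /= => /eqP; rewrite subr_eq0 => /eqP <-.
by rewrite subrK.
Qed.

End LieBrackets.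

(** * Submodules and operators with eigenvalues 1, 0 and -1 *)

Section Submodules.
Context {K : comUnitRingType} {V : lmodType K}.
Implicit Types (A B C : set V) (D h : {linear V -> V}).

Lemma submoduleN A x : is_submodule A -> A x -> A (- x).
Proof. by case=> _ _ AZ Ax; rewrite -scaleN1r; apply: AZ. Qed.

Lemma submoduleB A x y : is_submodule A -> A x -> A y -> A (x - y).
Proof.
by move=> sA Ax Ay; have [_ AD _] := sA; apply: AD => //; exact: submoduleN.
Qed.

Lemma submodule_add A B :
  is_submodule A -> is_submodule B -> is_submodule (set_add A B).
Proof.
move=> [A0 AD AZ] [B0 BD BZ]; split.
- by exists 0 => //; exists 0 => //; rewrite addr0.
- move=> _ _ [a Aa [b Bb <-]] [a' Aa' [b' Bb' <-]].
  exists (a + a'); first exact: AD.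
  by exists (b + b'); [exact: BD|rewrite addrACA].
- move=> k _ [a Aa [b Bb <-]]; exists (k *: a); first exact: AZ.
  by exists (k *: b); [exact: BZ|rewrite scalerDr].
Qed.

Lemma direct_sumE A B x : is_direct_sum A B ->
  exists a b, [/\ A a, B b & x = a + b].
Proof.
move=> [AB _]; have : setT x by [].
by rewrite -AB => -[a Aa [b Bb <-]]; exists a, b.
Qed.

Lemma direct_sum_eq0 A B x : is_direct_sum A B -> A x -> B x -> x = 0.
Proof. by move=> [_ AB] Ax Bx; have : (A `&` B) x by []; rewrite AB. Qed.

Lemma image_set_add (h : {linear V -> V}) A B :
  h @` set_add A B = set_add (h @` A) (h @` B).
Proof.
apply/seteqP; split.
- move=> _ [_ [a Aa [b Bb <-]] <-]; exists (h a); first by exists a.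
  by exists (h b); [exists b|rewrite linearD].
- move=> _ [_ [a Aa <-] [_ [b Bb <-] <-]].
  exists (a + b); last by rewrite linearD.
  by exists a => //; exists b.
Qed.

Lemma scale_unitK (k : K) :
  k \is a GRing.unit -> cancel ( *:%R k : V -> V) ( *:%R k^-1).
Proof. by move=> ku x; rewrite scalerA mulVr // scale1r. Qed.

Hypothesis two_unit : (2%:R : K) \is a GRing.unit.

Lemma double_inj (x y : V) : x + x = y + y -> x = y.
Proof.
move=> xy; apply: (can_inj (scale_unitK two_unit)).
by rewrite /= !scaler_nat !mulr2n.
Qed.

Lemma double_eq0 (x : V) : x + x = 0 -> x = 0.
Proof. by move=> xx; apply: double_inj; rewrite xx addr0. Qed.

(** A sum decomposition suffices, because [D] itself separates the components:
    [x = a + b + c] has [D x = a - c] and [D (D x) = a + c], which determine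
    [a] and [c] once 2 is invertible. *)
Lemma three_eigenspaces (D : {linear V -> V}) A B C :
    (forall a, A a -> D a = a) -> (forall b, B b -> D b = 0) ->
    (forall c, C c -> D c = - c) ->
    (forall x, exists a b c, [/\ A a, B b, C c & x = a + b + c]) ->
  [/\ D \o D \o D = D, [set x | D x = 1 *: x] = A,
      [set x | D x = 0 *: x] = B & [set x | D x = -1 *: x] = C].
Proof.
move=> DA DB DC dec.
have D1 a b c : A a -> B b -> C c -> D (a + b + c) = a - c.
  by move=> Aa Bb Cc; rewrite !linearD /= DA // DB // DC // addr0.
have D2 a c : A a -> C c -> D (a - c) = a + c.
  by move=> Aa Cc; rewrite linearB /= DA // DC // opprK.
have D3 a c : A a -> C c -> D (a + c) = a - c.
  by move=> Aa Cc; rewrite linearD /= DA // DC.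
split.
- apply: funext => x /=; have [a [b [c [Aa Bb Cc ->]]]] := dec x.
  by rewrite D1 // D2 // D3.
- apply/seteqP; split=> x /=; last by move=> /DA->; rewrite scale1r.
  rewrite scale1r => Dx; have [a [b [c [Aa Bb Cc xE]]]] := dec x.
  have x1 : x = a - c by rewrite -[LHS]Dx xE D1.
  have x2 : x = a + c by rewrite -[LHS]Dx x1 D2.
  suff -> : x = a by [].
  by apply: double_inj; rewrite {1}x1 x2 addrACA addNr addr0.
- apply/seteqP; split=> x /=; last by move=> /DB->; rewrite scale0r.
  rewrite scale0r => Dx; have [a [b [c [Aa Bb Cc xE]]]] := dec x.
  have x1 : a - c = 0 by rewrite -Dx xE D1.
  have x2 : a + c = 0 by rewrite -D2 // x1 linear0.
  have a0 : a = 0.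
    apply: double_eq0.
    by rewrite -[LHS]addr0 -[X in _ + X](addNr c) addrACA x1 x2 addr0.
  by rewrite xE a0 add0r; move: x2; rewrite a0 add0r => ->; rewrite addr0.
- apply/seteqP; split=> x /=; last by move=> /DC->; rewrite scaleN1r.
  rewrite scaleN1r => Dx; have [a [b [c [Aa Bb Cc xE]]]] := dec x.
  have x1 : x = c - a by apply: oppr_inj; rewrite opprB -Dx xE D1.
  have x2 : x = a + c by rewrite -[LHS]opprK -Dx -linearN x1 opprB D2.
  suff -> : x = c by [].
  by apply: double_inj; rewrite {1}x1 x2 addrA subrK.
Qed.

End Submodules.

(** * Filtrations and Euler operators *)

(** The bracket conditions for a flag [(f_1, f_0)]; those with a total index
    of at most -1 are vacuous. *)
Record is_3filtration (K : comUnitRingType) (g : lieAlgType K) (f : flag g) :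
    Prop := {
  filt1_submodule : is_submodule f.1 ;
  filt0_submodule : is_submodule f.2 ;
  filt1_sub0 : f.1 `<=` f.2 ;
  filt_lie11 : forall x y, f.1 x -> f.1 y -> ad x y = 0 ;
  filt_lie01 : forall x y, f.2 x -> f.1 y -> f.1 (ad x y) ;
  filt_lie00 : forall x y, f.2 x -> f.2 y -> f.2 (ad x y) ;
  filt_lie1 : forall x y, f.1 y -> f.2 (ad x y)
}.

Section Euler.
Context {K : comUnitRingType} {g : lieAlgType K}.
Hypothesis two_unit : (2%:R : K) \is a GRing.unit.
Hypothesis three_unit : (3%:R : K) \is a GRing.unit.
Implicit Types (E x y : g) (e f : flag g).

Lemma half_double x : 2%:R^-1 *: (x + x) = x.
Proof. by rewrite -mulr2n -scaler_nat scale_unitK. Qed.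

Lemma euler_cube E x : is_euler E -> ad E (ad E (ad E x)) = ad E x.
Proof. by move=> /(congr1 (@^~ x)). Qed.

(** For [D ^ 3 = D], the operators [(D ^ 2 + D) / 2], [1 - D ^ 2] and
    [(D ^ 2 - D) / 2] are the projections onto the eigenspaces. *)
Lemma euler_decomposition E x : is_euler E -> exists a b c,
  [/\ ad E a = a, ad E b = 0, ad E c = - c & x = a + b + c].
Proof.
move=> EE.
exists (2%:R^-1 *: (ad E (ad E x) + ad E x)), (x - ad E (ad E x)),
  (2%:R^-1 *: (ad E (ad E x) - ad E x)).
split.
- by rewrite linearZ linearD /= euler_cube // addrC.
- by rewrite linearB /= euler_cube // subrr.
- by rewrite linearZ linearB /= euler_cube // -scalerN opprB.
- rewrite addrAC -scalerDr addrACA subrr addr0 half_double addrCA subrr.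
  by rewrite addr0.
Qed.

(** On an element of weight 2, [ad E ^ 3] is multiplication by 8, so that
    [6 x = 0].  This is what truncates the grading at weight 1. *)
Lemma euler_weight2_eq0 E x : is_euler E -> ad E x = x + x -> x = 0.
Proof.
move=> EE; rewrite -mulr2n -scaler_nat => Ex.
have := euler_cube x EE; rewrite Ex !linearZ /=.
move=> /(can_inj (scale_unitK two_unit)); rewrite Ex linearZ /= Ex => x4.
have : 3%:R *: x = 0.
  apply: (addIr x); rewrite add0r -[RHS]x4 -[X in _ + X]scale1r -scalerDl.
  by rewrite scalerA -natrM -[X in _ + X]/(1%:R) -natrD.
by move=> /(congr1 ( *:%R 3%:R^-1)); rewrite scale_unitK // scaler0.
Qed.

Lemma fplus1E E x : (fplus (ad E)).1 x <-> ad E x = x.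
Proof. by rewrite /= /eigen_submodule /= scale1r. Qed.

Lemma fplus0E E x : (fplus (ad E)).2 x <->
  exists a b, [/\ ad E a = 0, ad E b = b & x = a + b].
Proof.
split=> [[a /= Ea [b /= Eb <-]]|[a [b [Ea Eb ->]]]].
  by exists a, b; rewrite Ea scale0r Eb scale1r.
exists a; first by rewrite /eigen_submodule /= Ea scale0r.
by exists b => //; rewrite /eigen_submodule /= Eb scale1r.
Qed.

Lemma eigen_submodule_submodule E (i : K) :
  is_submodule (eigen_submodule (ad E) i).
Proof.
rewrite /eigen_submodule; split=> /= [|x y xi yi|k x xi].
- by rewrite linear0 scaler0.
- by rewrite linearD /= xi yi scalerDr.
- by rewrite linearZ /= xi !scalerA mulrC.
Qed.

Lemma fplus_3filtration E : is_euler E -> is_3filtration (fplus (ad E)).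
Proof.
move=> EE.
have sub1 : is_submodule (fplus (ad E)).1 by exact: eigen_submodule_submodule.
have sub0 : is_submodule (fplus (ad E)).2.
  by apply: submodule_add; exact: eigen_submodule_submodule.
have f10 : (fplus (ad E)).1 `<=` (fplus (ad E)).2.
  move=> x /fplus1E Ex; apply/fplus0E; exists 0, x.
  by rewrite linear0 add0r.
have lie11 x y : (fplus (ad E)).1 x -> (fplus (ad E)).1 y -> ad x y = 0.
  move=> /fplus1E Ex /fplus1E Ey; apply: euler_weight2_eq0 (EE) _.
  by rewrite ad_leibniz Ex Ey.
have lie01 x y : (fplus (ad E)).2 x -> (fplus (ad E)).1 y ->
    (fplus (ad E)).1 (ad x y).
  move=> /fplus0E[a [b [Ea Eb ->]]] fy; have Ey := (fplus1E _ _).1 fy.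
  rewrite adDl (lie11 b) ?addr0 //; last exact/fplus1E.
  by apply/fplus1E; rewrite ad_leibniz Ea Ey ad0l add0r.
split=> //.
- move=> x y fx /fplus0E[a [b [Ea Eb ->]]]; rewrite linearD /=.
  case: (sub0) => _ addf _; apply: addf; last first.
    by apply/f10/lie01 => //; exact/fplus1E.
  case/fplus0E: fx => [c [d [Ec Ed ->]]]; apply/fplus0E.
  exists (ad c a), (ad d a); rewrite !(ad_leibniz E) Ea Ec Ed.
  by rewrite linear0 ad0l linear0 !addr0 adDl.
- move=> x y fy; have Ey := (fplus1E _ _).1 fy.
  have [a [b [c [Ea Eb Ec ->]]]] := euler_decomposition x EE.
  rewrite !adDl (lie11 a) // ?add0r; last exact/fplus1E.
  apply/fplus0E; exists (ad c y), (ad b y); rewrite !(ad_leibniz E).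
  by rewrite Eb Ec Ey adNl addNr ad0l add0r [ad c y + _]addrC.
Qed.

Lemma euler_opp E : is_euler E -> is_euler (- E).
Proof.
move=> EE; apply: funext => x /=.
by rewrite !adNl !(linearN (ad E)) opprK /= euler_cube.
Qed.

(** Replacing [E] by [- E] exchanges the two filtrations, so everything proved
    for [fplus] transfers to [fminus]. *)
Lemma fminus_opp E : fminus (ad E) = fplus (ad (- E)).
Proof.
have eigN i : eigen_submodule (ad (- E)) i = eigen_submodule (ad E) (- i).
  apply/seteqP; rewrite /eigen_submodule.
  split=> x /=; rewrite adNl scaleNr; [move=> <-|move=> ->];
  by rewrite opprK.
by rewrite /fminus /fplus !eigN oppr0.
Qed.

Lemma fplus_opp E : fplus (ad E) = fminus (ad (- E)).
Proof. by rewrite fminus_opp opprK. Qed.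

Lemma inner_fplus E : is_euler E -> inner_3filtrations g (fplus (ad E)).
Proof. by move=> EE; exists (ad E) => //; exists E. Qed.

Lemma inner_fminus E : is_euler E -> inner_3filtrations g (fminus (ad E)).
Proof. by move=> EE; rewrite fminus_opp; apply/inner_fplus/euler_opp. Qed.

Lemma transversal_flags_sym e f :
  transversal_flags e f -> transversal_flags f e.
Proof. by case. Qed.

Lemma fplus_fminus_transversal E : is_euler E ->
  transversal_flags (fplus (ad E)) (fminus (ad E)).
Proof.
suff dsum E' : is_euler E' ->
    is_direct_sum (fplus (ad E')).1 (fminus (ad E')).2.
  move=> EE; split; first exact: dsum.
  by have := dsum _ (euler_opp EE); rewrite -fminus_opp -fplus_opp.
move=> EE; rewrite fminus_opp; split.
- apply/seteqP; split=> // x _.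
  have [a [b [c [Ea Eb Ec ->]]]] := euler_decomposition x EE.
  exists a; first exact/fplus1E.
  exists (b + c); last by rewrite addrA.
  by apply/fplus0E; exists b, c; rewrite !adNl Eb Ec oppr0 opprK.
- apply/seteqP; split=> x; last first.
    move=> ->; split; first by apply/fplus1E; rewrite linear0.
    by apply/fplus0E; exists 0, 0; rewrite !linear0 addr0.
  move=> [/fplus1E Ex /fplus0E[b [c]]]; rewrite !adNl.
  move=> [/eqP]; rewrite oppr_eq0 => /eqP Eb.
  move=> /(congr1 -%R); rewrite opprK => Ec xE.
  have x1 : x = - c by rewrite -Ex xE linearD /= Eb Ec add0r.
  have x2 : x = c by rewrite -Ex x1 linearN /= Ec opprK.
  by apply: (double_eq0 two_unit); rewrite {1}x1 x2 addNr.
Qed.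

(** The eigenspace of weight 0 is the intersection of the two larger members of
    the flags, so the flags determine all three eigenspaces. *)
Lemma fplus_fminus_inj E E' : is_euler E -> is_euler E' ->
  fplus (ad E) = fplus (ad E') -> fminus (ad E) = fminus (ad E') ->
  ad E = ad E'.
Proof.
move=> EE EE'; rewrite !fminus_opp => pE mE; apply: funext => x.
have [a [b [c [Ea Eb Ec ->]]]] := euler_decomposition x EE.
have E'a : ad E' a = a by apply/fplus1E; rewrite -pE; exact/fplus1E.
have E'c : ad E' c = - c.
  apply: oppr_inj; rewrite opprK -adNl; apply/fplus1E; rewrite -mE.
  by apply/fplus1E; rewrite adNl Ec opprK.
have E'b : ad E' b = 0.
  have /fplus0E[b1 [c1 [E'b1 E'c1 b1E]]] : (fplus (ad E')).2 b.
    by rewrite -pE; apply/fplus0E; exists b, 0; rewrite linear0 addr0.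
  have /fplus0E[b2 [c2 []]] : (fplus (ad (- E'))).2 b.
    rewrite -mE; apply/fplus0E; exists b, 0.
    by rewrite !adNl Eb !linear0 addr0.
  rewrite !adNl => /(congr1 -%R); rewrite opprK oppr0 => E'b2.
  move=> /(congr1 -%R); rewrite opprK => E'c2 b2E.
  have c1E : ad E' b = c1 by rewrite b1E linearD /= E'b1 E'c1 add0r.
  have c2E : ad E' b = - c2 by rewrite b2E linearD /= E'b2 E'c2 add0r.
  have c12 : c1 = c2 by rewrite -E'c1 -c1E c2E linearN /= E'c2 opprK.
  by apply: (double_eq0 two_unit); rewrite {1}c2E c1E c12 addNr.
by rewrite !linearD /= Ea Eb Ec E'a E'b E'c.
Qed.

(** The key step: [E - a] is the component of [E] in the intersection of
    [(fplus (ad E)).2] and [e.2].  That [a] has weight 1 is what later turns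
    this into transitivity of the exponential action. *)
Lemma euler_of_transversal E e :
  is_euler E -> is_3filtration e -> transversal_flags e (fplus (ad E)) ->
  exists a, [/\ ad E a = a, is_euler (E - a),
    fplus (ad (E - a)) = fplus (ad E) & fminus (ad (E - a)) = e].
Proof.
move=> EE eF; set f := fplus (ad E) => -[ef fe].
have fF : is_3filtration f by exact: fplus_3filtration.
have fE : f.2 E by apply/fplus0E; exists E, 0; rewrite adxx linear0 addr0.
have [a [h [fa eh EE']]] := direct_sumE E fe.
have hE : E - a = h by rewrite EE' addrC addKr.
have fh : f.2 h.
  rewrite -hE; apply: submoduleB (filt0_submodule fF) _ _ => //.
  exact: filt1_sub0.
exists a; rewrite hE.
(* [ad a] vanishes on [f.1], which is abelian. *)
have h1 x : f.1 x -> ad h x = x.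
  move=> fx; rewrite -hE adBl (filt_lie11 fF fa fx) subr0.
  exact/fplus1E.
(* [ad h] and [ad E] agree modulo [f.1] on [f.2], and [ad h] preserves [e.2],
   while [f.1] and [e.2] intersect trivially. *)
have h0 x : (f.2 `&` e.2) x -> ad h x = 0.
  move=> [fx ex]; apply: (direct_sum_eq0 fe); last exact: filt_lie00 eF _ _ _ _.
  rewrite -hE adBl; apply: (submoduleB (filt1_submodule fF)).
    have /fplus0E[b [c [Eb Ec ->]]] := fx.
    by apply/fplus1E; rewrite linearD /= Eb Ec add0r.
  by rewrite adC; apply: submoduleN (filt1_submodule fF) _; exact: filt_lie01.
(* [ad E + 1] maps [g] into [f.2] and so does [ad a]; moreover [ad h] preserves
   [e.1], which meets [f.2] trivially. *)
have hm x : e.1 x -> ad h x = - x.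
  move=> ex; apply/eqP; rewrite -addr_eq0; apply/eqP.
  apply: (direct_sum_eq0 ef).
    have [_ addE _] := filt1_submodule eF; apply: addE => //.
    exact: filt_lie01.
  rewrite -hE adBl addrAC; apply: (submoduleB (filt0_submodule fF)).
    have [b [c [d [Eb Ec Ed ->]]]] := euler_decomposition x EE.
    apply/fplus0E; exists c, (b + b); rewrite !linearD /= Eb Ec Ed.
    split=> //.
    by rewrite addr0 addrACA addNr addr0 addrA [RHS]addrC.
  by rewrite adC; apply: submoduleN (filt0_submodule fF) _; exact: filt_lie1.
(* Modular law: [e.2] splits along [g = e.1 + f.2], as it contains [e.1]. *)
have dec x : exists b c d, [/\ f.1 b, (f.2 `&` e.2) c, e.1 d & x = b + c + d].
  have [b [y [fb ey ->]]] := direct_sumE x fe.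
  have [d [c [ed fc yE]]] := direct_sumE y ef.
  exists b, c, d; split=> //; last by rewrite yE [d + c]addrC addrA.
  split=> //; have -> : c = y - d by rewrite yE addrC addKr.
  by apply: submoduleB (filt0_submodule eF) _ _ => //; exact: filt1_sub0.
have [hEu eig1 eig0 eigm] := three_eigenspaces two_unit h1 h0 hm dec.
split=> //; first by apply/fplus1E; exact: fa.
- rewrite /fplus /eigen_submodule eig1 eig0 [RHS]surjective_pairing; congr pair.
  apply/seteqP; split.
    move=> _ [b [fb _] [c fc <-]].
    have [_ addf _] := filt0_submodule fF; apply: addf => //.
    exact: filt1_sub0.
  move=> x fx; have [b [y [fb ey xE]]] := direct_sumE x fe.
  exists y; last by exists b => //; rewrite addrC xE.
  split=> //; have -> : y = x - b by rewrite xE addrC addKr.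
  by apply: submoduleB (filt0_submodule fF) _ _ => //; exact: filt1_sub0.
- rewrite /fminus /eigen_submodule eigm eig0 [RHS]surjective_pairing.
  congr pair.
  apply/seteqP; split.
    move=> _ [b [_ eb] [c ec <-]].
    have [_ adde _] := filt0_submodule eF; apply: adde => //.
    exact: filt1_sub0.
  move=> x ex; have [b [y [eb fy xE]]] := direct_sumE x ef.
  exists y; last by exists b => //; rewrite addrC xE.
  split=> //; have -> : y = x - b by rewrite xE addrC addKr.
  by apply: submoduleB (filt0_submodule eF) _ _ => //; exact: filt1_sub0.
Qed.


(** * The exponential action on flags *)

Lemma exp_ad_is_linear x : linear (exp_ad x).
Proof.
move=> k y z; rewrite /exp_ad !(linearP (ad x)) /= !scalerDr !scalerA (mulrC k).
by rewrite [RHS]addrACA; congr (_ + _); rewrite addrACA.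
Qed.

HB.instance Definition _ x :=
  GRing.isLinear.Build K g g *:%R (exp_ad x) (exp_ad_is_linear x).

(** Each bracket with an element of [f.1] raises the filtration degree by one,
    and there are only three steps from [g] to 0. *)
Lemma filt_ad3 f x y z w :
  is_3filtration f -> f.1 x -> f.1 y -> f.1 z -> ad x (ad y (ad z w)) = 0.
Proof.
move=> fF fx fy fz; apply: (filt_lie11 fF fx).
rewrite adC; apply: submoduleN (filt1_submodule fF) _.
apply: (filt_lie01 fF) => //.
by rewrite adC; apply: submoduleN (filt0_submodule fF) _; exact: filt_lie1.
Qed.

Lemma exp_ad0 : exp_ad 0 = id :> (g -> g).
Proof. by apply: funext => y; rewrite /exp_ad !ad0l scaler0 !addr0. Qed.

(** The usual functional equation for the commuting operators [ad x] and [ad y]: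
    only the terms of degree at most 2 survive. *)
Lemma exp_adD f x y : is_3filtration f -> f.1 x -> f.1 y ->
  exp_ad (x + y) = exp_ad x \o exp_ad y.
Proof.
move=> fF fx fy; apply: funext => w.
have xyC : ad y (ad x w) = ad x (ad y w).
  by rewrite ad_leibniz (filt_lie11 fF fy fx) ad0l add0r.
have a3 := filt_ad3 w fF.
rewrite /= /exp_ad !adDl !(linearD, linearZ) /=.
rewrite !a3 // (linear0 (ad x)) !scaler0 !addr0 xyC.
set p := _ *: ad x (ad x w); set q := _ *: ad x (ad y w).
set r := _ *: ad y (ad y w).
have -> : ad x (ad y w) = q + q by rewrite -scalerDr half_double.
by rewrite (AC (1*2*(2*2)) (1*3*7*(2*(5*6))*4)).
Qed.

(** [E - x] is the image of [E] under [exp_ad x], since [ad x E = - x] and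
    [ad x (ad x E) = 0].  The conjugation formula is the commutation rule
    [ad E (ad x u) = ad x u + ad x (ad E u)] carried through the exponential. *)
Lemma exp_ad_intertwine E x w :
    ad E x = x -> ad x (ad x (ad x w)) = 0 ->
  ad (E - x) (exp_ad x w) = exp_ad x (ad E w).
Proof.
move=> Ex x3.
have EX u : ad E (ad x u) = ad x u + ad x (ad E u) by rewrite ad_leibniz Ex.
have EXX : ad E (ad x (ad x w)) =
    ad x (ad x w) + ad x (ad x w) + ad x (ad x (ad E w)).
  by rewrite EX EX linearD /= addrA.
rewrite /exp_ad adBl !(linearD, linearZ) /= EXX EX x3 oppr0 scaler0 addr0.
rewrite scalerDr half_double.
by rewrite (AC (1*2*2*2) (1*3*5*((2*6)*(4*7)))) /= !subrr !addr0.
Qed.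

Lemma image_eigen (h h' D D' : {linear g -> g}) (i : K) :
    cancel h h' -> cancel h' h -> (forall x, D' (h x) = h (D x)) ->
  h @` eigen_submodule D i = eigen_submodule D' i.
Proof.
rewrite /eigen_submodule => hK h'K hD; apply/seteqP.
split=> [_ [x /= Dx <-]|x /= Dx].
  by rewrite hD Dx linearZ.
by exists (h' x) => //=; apply: (can_inj hK); rewrite -hD h'K Dx linearZ /= h'K.
Qed.

Lemma exp_adK f x : is_3filtration f -> f.1 x ->
  cancel (exp_ad x) (exp_ad (- x)).
Proof.
move=> fF fx y.
have fNx : f.1 (- x) by exact: submoduleN (filt1_submodule fF) _.
by rewrite -[LHS]/((exp_ad (- x) \o exp_ad x) y) -(exp_adD fF) // addNr exp_ad0.
Qed.

Lemma flag_image_exp_ad E x : is_euler E -> ad E x = x ->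
  [/\ is_euler (E - x),
      flag_image (exp_ad x) (fplus (ad E)) = fplus (ad (E - x))
    & flag_image (exp_ad x) (fminus (ad E)) = fminus (ad (E - x))].
Proof.
move=> EE Ex; have fF := fplus_3filtration EE.
have /fplus1E fx := Ex.
have /fplus1E fNx : ad E (- x) = - x by rewrite linearN /= Ex.
have expK := exp_adK fF fx.
have expNK : cancel (exp_ad (- x)) (exp_ad x).
  by have := exp_adK fF fNx; rewrite opprK.
have expE y : ad (E - x) (exp_ad x y) = exp_ad x (ad E y).
  by apply: exp_ad_intertwine => //; exact: (filt_ad3 _ fF).
have eigE i := image_eigen i expK expNK expE.
split.
- apply: funext => y /=.
  by rewrite -(expNK y) !expE euler_cube.
- by rewrite /flag_image /fplus /= image_set_add !eigE.
- by rewrite /flag_image /fminus /= image_set_add !eigE.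
Qed.

(** [exp_ad x] differs from the identity by brackets with [x], which raise the
    filtration degree; the same holds for its inverse. *)
Lemma flag_image_exp_ad_stable f x : is_3filtration f -> f.1 x ->
  flag_image (exp_ad x) f = f.
Proof.
move=> fF.
suff sub y : f.1 y -> exp_ad y @` f.1 `<=` f.1 /\ exp_ad y @` f.2 `<=` f.2.
  move=> fx.
  have fNx : f.1 (- x) by exact: submoduleN (filt1_submodule fF) _.
  have expNK : cancel (exp_ad (- x)) (exp_ad x).
    by have := exp_adK fF fNx; rewrite opprK.
  have [s1 s0] := sub _ fx; have [sN1 sN0] := sub _ fNx.
  rewrite [RHS]surjective_pairing; congr pair; apply/seteqP; split=> // z fz.
    by exists (exp_ad (- x) z) => //; apply: sN1; exists z.
  by exists (exp_ad (- x) z) => //; apply: sN0; exists z.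
move=> fy; split=> _ [z fz <-]; rewrite /exp_ad.
  by rewrite !(filt_lie11 fF fy fz) linear0 scaler0 !addr0.
have [_ addf scalef] := filt0_submodule fF.
have fyz u : f.2 (ad y u).
  by rewrite adC; apply: submoduleN (filt0_submodule fF) _; exact: filt_lie1.
by apply: (addf); [exact: addf|exact: scalef].
Qed.

End Euler.

(** * Transversal pairs and the affine structure *)

Theorem theorem1p6 (K : comUnitRingType)
    (two_unit : (2%:R : K) \is a GRing.unit)
    (three_unit : (3%:R : K) \is a GRing.unit)
    (g : lieAlgType K) :
  [/\ set_bij (inner_3gradings g) (transversal_pairs g)
        (fun D => (fplus D, fminus D)),
      forall e f : flag g, inner_3filtrations g e -> inner_3filtrations g f ->
        (transversal_flags e f <->
         exists E : g, [/\ is_euler E, f = fplus (ad E) & e = fminus (ad E)])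
    & forall f : flag g, inner_3filtrations g f ->
        is_affine_space f.1 (transversal_to f)
          (fun x => flag_image (exp_ad x))].
Proof.
have transP e f : inner_3filtrations g e -> inner_3filtrations g f ->
    transversal_flags e f <->
    exists E : g, [/\ is_euler E, f = fplus (ad E) & e = fminus (ad E)].
  move=> [_ [E' EE' <-] <-] [_ [E EE <-] <-]; split.
    move=> ef.
    have [a [_ aE <- <-]] := euler_of_transversal two_unit three_unit EE
      (fplus_3filtration two_unit three_unit EE') ef.
    by exists (E - a).
  move=> [H [HE -> ->]]; apply: transversal_flags_sym.
  exact: fplus_fminus_transversal.
split=> //.
- split.
  + move=> _ [E EE <-]; split; [exact: inner_fplus|exact: inner_fminus|].
    exact: fplus_fminus_transversal.
  + move=> _ _ /set_mem[E EE <-] /set_mem[E' EE' <-] fE.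
    apply: fplus_fminus_inj => //; first exact: (congr1 fst fE).
    exact: (congr1 snd fE).
  + move=> [e f] [/= eI fI ef].
    have [E [EE -> ->]] := (transP _ _ fI eI).1 (transversal_flags_sym ef).
    by exists (ad E) => //; exists E.
- move=> _ [_ [E EE <-] <-]; set f := fplus (ad E).
  have fF : is_3filtration f by exact: fplus_3filtration.
  have fI : inner_3filtrations g f by exact: inner_fplus.
  have base e : transversal_to f e ->
      exists H, [/\ is_euler H, f = fplus (ad H) & e = fminus (ad H)].
    by move=> [eI ef]; apply/transP.
  (* [exp_ad x] fixes [f] and translates the Euler operators inducing [f]. *)
  have shift H x : is_euler H -> f = fplus (ad H) -> f.1 x ->
      [/\ is_euler (H - x), f = fplus (ad (H - x)) &
       flag_image (exp_ad x) (fminus (ad H)) = fminus (ad (H - x))].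
    move=> HE fH fx.
    have Hx : ad H x = x by apply/fplus1E; rewrite -fH.
    have [HxE pE mE] := flag_image_exp_ad two_unit three_unit HE Hx.
    by split=> //; rewrite -pE -fH flag_image_exp_ad_stable.
  split.
  + exact: filt1_submodule.
  + exists (fminus (ad E)); split; first exact: inner_fminus.
    by apply/transP => //; [exact: inner_fminus|exists E].
  + move=> x e fx /base[H [HE fH ->]].
    have [HxE fHx ->] := shift _ _ HE fH fx.
    split; first exact: inner_fminus.
    by apply/transP => //; [exact: inner_fminus|exists (H - x)].
  + by move=> e _; rewrite exp_ad0 /flag_image !image_id -surjective_pairing.
  + move=> x y e fx fy _.
    by rewrite (exp_adD two_unit fF fx fy) /flag_image /= !image_comp.
  + move=> p q pf /base[H' [HE' fH' qE]].
    have pF : is_3filtration p.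
      have [[_ [P PE <-] <-] _] := pf; exact: fplus_3filtration.
    have [a [Ha HE fH pE]] : exists a, [/\ ad H' a = a, is_euler (H' - a),
        fplus (ad (H' - a)) = fplus (ad H') & fminus (ad (H' - a)) = p].
      by apply: euler_of_transversal => //; rewrite -fH'; have [] := pf.
    have fa : f.1 a by rewrite fH'; apply/fplus1E.
    have fNa : f.1 (- a) by exact: submoduleN (filt1_submodule fF) _.
    rewrite -fH' in fH.
    (* [p] belongs to [H' - a], and subtracting [- a] leads back to [H']. *)
    exists (- a); split.
      split=> //; rewrite -pE qE.
      by have [_ _ ->] := shift _ _ HE (esym fH) fNa; rewrite opprK subrK.
    move=> x [fx]; rewrite -pE qE.
    have [HxE fHx ->] := shift _ _ HE (esym fH) fx => mE.
    have : ad (H' - a - x) = ad H'.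
      by apply: fplus_fminus_inj => //; rewrite -fHx.
    (* Evaluating at [H'] recovers the translation vector, as [ad y H' = - y]
       for [y] in [f.1]. *)
    move=> /(congr1 (@^~ H')); rewrite adxx !adBl adxx sub0r.
    have HH' y : f.1 y -> ad y H' = - y.
      by rewrite fH' adC => /fplus1E ->.
    by rewrite !HH' // !opprK => /eqP; rewrite addrC addr_eq0 => /eqP ->.
Qed.
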